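(* Let $\{\lambda_N\}_{N\ge 1}$ be a sequence of probability measures on $\mathbb{R}^n$ which satisfies the large deviation principle with a good, strictly quasi-convex rate function $\mathcal{I}$. For every $N$ let $\xi^{(N)}_i$, $1\le i\le 2^N$, be i.i.d. $\mathbb{R}^n$-valued random variables with law $\lambda_N$ (for all $N$ defined on one probability space), and for each sample point $\omega$ let $$\mu_N(\omega)=\frac{1}{2^N}\sum_{i=1}^{2^N}\delta_{\xi^{(N)}_i(\omega)}$$ be their empirical measure. Then for almost every $\omega$ the sequence $\{\mu_N(\omega)\}_{N\ge1}$ satisfies the large deviation principle with rate function $\mathcal{J}$ given by $$\mathcal{J}(x)=\begin{cases}\mathcal{I}(x) & \text{if } \mathcal{I}(x)\le \log 2,\\ \infty & \text{if } \mathcal{I}(x)>\log 2.\end{cases}$$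
   Context: A sequence $\{\mu_N\}$ of probability measures on a Polish space $\mathbb{X}$ satisfies the large deviation principle (LDP) with rate function $\mathcal{I}$ if $\mathcal{I}:\mathbb{X}\to[0,\infty]$ is lower semicontinuous and for every Borel set $B$, $-\inf_{x\in B^0}\mathcal{I}(x)\le\liminf_N\frac1N\log\mu_N(B)\le\limsup_N\frac1N\log\mu_N(B)\le-\inf_{x\in\overline{B}}\mathcal{I}(x)$. The rate function is good if $\{\mathcal{I}\le a\}$ is compact for all $0\le a<\infty$. A function $f$ with values in $(-\infty,+\infty]$ on a convex set is strictly quasi-convex if for any two distinct $x_1,x_2\in\{f<\infty\}$ and each $\theta\in(0,1)$, $f(\theta x_1+(1-\theta)x_2)<\max\{f(x_1),f(x_2)\}$. *)

(* Defs.v *)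
From HB Require Import structures.
From mathcomp Require Import all_boot all_order all_algebra.
From mathcomp Require Import all_classical all_reals all_analysis.

Set Implicit Arguments.
Unset Strict Implicit.
Unset Printing Implicit Defensive.

Import Order.TTheory GRing.Theory Num.Theory.
Import numFieldNormedType.Exports.

Local Open Scope classical_set_scope.
Local Open Scope ring_scope.
Local Open Scope ereal_scope.

Definition borel (X : ptopologicalType) := g_sigma_algebraType (@open X).

HB.instance Definition _ (X : ptopologicalType) := Measurable.on (borel X).

Section large_deviations.
Context {R : realType} {X : ptopologicalType}.
Implicit Types (mu : nat -> probability (borel X) R) (I : X -> \bar R).

(* [lne 0 = -oo] and the infimum over the empty set is [+oo].  The value at
   [N = 0] (where [N%:R^-1 = 0]) does not affect the limits. *)
Definition log_rate mu (B : set X) (N : nat) : \bar R :=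
  (N%:R^-1)%:E * lne (mu N B).

Definition LDP mu I : Prop :=
  [/\ forall x, 0 <= I x,
      lower_semicontinuous I &
      forall B : set (borel X), measurable B ->
        [/\ - ereal_inf (I @` interior (B : set X))
              <= limn_einf (log_rate mu B),
            limn_einf (log_rate mu B) <= limn_esup (log_rate mu B) &
            limn_esup (log_rate mu B)
              <= - ereal_inf (I @` closure (B : set X))]].

Definition good_rate I : Prop :=
  forall a : R, (0 <= a)%R -> compact [set x | I x <= a%:E].

Definition truncated_rate (c : R) I (x : X) : \bar R :=
  if I x <= c%:E then I x else +oo.

End large_deviations.

Definition strictly_quasi_convex {R : realType} {V : lmodType R}
    (f : V -> \bar R) : Prop :=
  forall (x1 x2 : V) (t : R), x1 != x2 -> f x1 < +oo -> f x2 < +oo ->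
    (0 < t < 1)%R ->
    f (t *: x1 + (1 - t) *: x2)%R < maxe (f x1) (f x2).

Section independence.
Context {R : realType} {d d' : measure_display}.
Context {Omega : measurableType d} {T : measurableType d'}.
Variable P : probability Omega R.

Definition mutually_independent (K : finType) (X : K -> {RV P >-> T}) : Prop :=
  forall (J : {set K}) (B : K -> set T), (forall k, measurable (B k)) ->
    P [set w | forall k, k \in J -> B k (X k w)] =
    \prod_(k in J) P [set w | B k (X k w)].

Definition has_law (X : {RV P >-> T}) (nu : probability T R) : Prop :=
  forall B : set T, measurable B -> distribution P X B = nu B.

End independence.

Section empirical_measure.
Context {R : realType} {d : measure_display} {T : measurableType d}.
Variables (m : nat) (m_gt0 : (0 < m)%N) (x : 'I_m -> T).

(* The unused [m_gt0] lets the probability instance below be inferred. *)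
Definition empirical of (0 < m)%N := fun A : set T =>
  (m%:R^-1)%:E * \sum_(i < m) \d_(x i) A : \bar R.

Local Notation emp := (empirical m_gt0).

Let empirical0 : emp set0 = 0.
Proof. by rewrite /empirical big1 ?mule0// => i _; rewrite measure0. Qed.

Let empirical_ge0 A : 0 <= emp A.
Proof. by rewrite /empirical mule_ge0// ?lee_fin// sume_ge0. Qed.

Let empirical_sigma_additive : semi_sigma_additive emp.
Proof.
move=> F mF tF mUF.
pose y (k : nat) := if insub k is Some i then x i else point.
have ge0m : (0 <= m%:R^-1 :> R)%R by [].
have E A : emp A = mscale (NngNum ge0m)
    (msum (fun k => dirac (y k) : {measure set T -> \bar R}) m) A.
  rewrite /empirical /mscale/= /msum; congr (_ * _).
  by apply: eq_bigr => i _; rewrite /y valK.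
rewrite E; under eq_fun do under eq_bigr do rewrite E.
exact: measure_semi_sigma_additive.
Qed.

HB.instance Definition _ := isMeasure.Build _ _ _ emp
  empirical0 empirical_ge0 empirical_sigma_additive.

Let empirical_setT : emp setT = 1.
Proof.
rewrite /empirical; under eq_bigr do rewrite diracT.
rewrite sumEFin sumr_const card_ord -EFinM mulVf//.
by rewrite pnatr_eq0 -lt0n.
Qed.

HB.instance Definition _ := Measure_isProbability.Build _ _ _ emp
  empirical_setT.

End empirical_measure.

Lemma pow2_gt0 (N : nat) : (0 < 2 ^ N)%N.
Proof. by rewrite expn_gt0. Qed.

(* Main.v *)
Require Import Defs.
From HB Require Import structures.
From mathcomp Require Import all_boot all_order all_algebra.
From mathcomp Require Import measurable_realfun ring lra.
From mathcomp Require Import all_classical all_reals all_analysis.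

Set Implicit Arguments.
Unset Strict Implicit.
Unset Printing Implicit Defensive.

Import Order.TTheory GRing.Theory Num.Theory.
Import numFieldNormedType.Exports.

Local Open Scope classical_set_scope.
Local Open Scope ring_scope.
Local Open Scope ereal_scope.

(** Write [mu_N] for the empirical measure of the [2 ^ N] sample points.  For a
    fixed Borel set [B] the number of points in [B] is a sum of pairwise
    independent indicators with mean [2 ^ N * lambda_N B], and

    - Markov's inequality keeps [mu_N B] below [e^{-N a}] as soon as
      [lambda_N B <= e^{-N b}] for some [b > a] ([sample_measure_upper]);
    - Chebyshev's inequality keeps [mu_N B] above [lambda_N B / 2] as soon as
      [2 ^ N * lambda_N B] grows exponentially, that is, as long as the rate of
      [B] is below [ln 2] ([sample_measure_lower]).

    Both failure probabilities decay geometrically in [N], so by the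
    Borel-Cantelli lemma the two bounds hold eventually, almost surely.

    The exceptional null set must not depend on [B].  Lower bounds are needed
    for the members of a countable base of the topology only, since any open
    neighbourhood of a point contains a member of the base.  For the upper
    bound, a closed set [C] on which [I > a] misses the compact sublevel set
    [I <= a]; the latter is covered by finitely many members of the base that
    miss [C], so [C] lies in the complement of such a finite union, on which
    [I > a] still holds ([good_rate_separation]).  There are countably many
    finite unions.  So almost surely [mu_N] has the upper bound of rate [I], and
    the lower bound of rate [I] at the points where [I < ln 2].

    It remains to pass from [I] to its truncation at [ln 2].  Above the level
    [ln 2] the upper bound improves by itself: the masses of [mu_N] are
    multiples of [2 ^- N], so a set of mass less than [2 ^- N] has mass zero
    ([truncated_exp_upper_bound]).  A point [x] with [I x = ln 2] gets its lower
    bound from nearby points of smaller rate: on the segment from [x] to a zero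
    of [I], strict quasi-convexity forces [I < ln 2]
    ([strictly_quasi_convex_approx]). *)

(** * Deviations of a number of occurrences *)

Section hits.
Context d (T : measurableType d) (R : realType) (P : probability T R).
Context (K : finType) (A : K -> set T).

Definition hits (w : T) : R := (\sum_k \1_(A k) w)%R.

Hypothesis mA : forall k, measurable (A k).

Lemma measurable_hits : measurable_fun setT hits.
Proof.
rewrite /hits; apply: measurable_sum => k.
exact: measurable_indic.
Qed.

Lemma hits_ge0 w : (0 <= hits w)%R.
Proof. by apply: sumr_ge0 => k _; rewrite indicE. Qed.

Lemma integral_hits : \int[P]_w (hits w)%:E = \sum_k P (A k).
Proof.
under eq_integral do rewrite /hits -sumEFin.
rewrite ge0_integral_sum//.
- by apply: eq_bigr => k _; rewrite integral_indic// setIT.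
- by move=> k; apply/measurable_EFinP; exact: measurable_indic.
Qed.

(** The square of the count is a double sum of indicators of intersections, so
    pairwise independence determines the second moment. *)
Lemma integral_sqr_hits :
  \int[P]_w ((hits w) ^+ 2)%:E = \sum_k \sum_l P (A k `&` A l).
Proof.
have E w : ((hits w) ^+ 2)%:E = \sum_k \sum_l (\1_(A k `&` A l) w)%:E.
  rewrite expr2 /hits mulr_suml -sumEFin; apply: eq_bigr => k _.
  rewrite mulr_sumr -sumEFin; apply: eq_bigr => l _.
  by rewrite indicI.
under eq_integral do rewrite E.
have mAA k l : measurable (A k `&` A l) by exact: measurableI.
have mi k l : measurable_fun setT (fun w => (\1_(A k `&` A l) w)%:E : \bar R).
  by apply/measurable_EFinP; exact: measurable_indic.
have i0 k l w : setT w -> 0 <= (\1_(A k `&` A l) w)%:E :> \bar R.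
  by move=> _; rewrite lee_fin indicE.
rewrite ge0_integral_sum//.
- apply: eq_bigr => k _; rewrite ge0_integral_sum//.
  by apply: eq_bigr => l _; rewrite integral_indic// setIT.
- by move=> k; exact: emeasurable_sum.
- by move=> k w Tw; apply: sume_ge0 => l _; exact: i0.
Qed.

End hits.

Lemma markov_ge0 d (T : measurableType d) (R : realType)
    (P : probability T R) (f : T -> R) (t : R) :
  measurable_fun setT f -> (forall w, 0 <= f w)%R -> (0 < t)%R ->
  t%:E * P [set w | t <= f w]%R <= \int[P]_w (f w)%:E.
Proof.
move=> mf f0 t0.
have := @le_integral_comp_abse _ _ _ P _ measurableT (EFin \o f) t id.
rewrite setTI /=.
under eq_integral do rewrite ger0_norm//.
have -> : [set x | t%:E <= `|f x|%:E] = [set w | t <= f w]%R.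
  by apply/seteqP; split=> w /=; rewrite lee_fin ger0_norm.
by apply => //; exact/measurable_EFinP.
Qed.

Section deviations.
Context d (T : measurableType d) (R : realType) (P : probability T R).
Context (K : finType) (A : K -> set T) (p : R).
Hypothesis mA : forall k, measurable (A k).
Hypothesis PA : forall k, P (A k) = p%:E.

Lemma hits_upper_tail (t : R) : (0 < t)%R ->
  P [set w | t <= hits R A w]%R <= (#|K|%:R * p / t)%:E.
Proof.
move=> t0; have := markov_ge0 P (measurable_hits mA) (hits_ge0 R A) t0.
rewrite integral_hits//; under eq_bigr do rewrite PA.
rewrite sumEFin sumr_const -lee_pdivlMl//.
by rewrite -EFinM mulr_natl mulrC.
Qed.

Hypothesis PAA : forall k l, k != l -> P (A k `&` A l) = (p ^+ 2)%:E.

(** Chebyshev's inequality.  With [m] the mean, the variance is computed from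
    the identity [(S - m)^2 + 2 m S = S^2 + m^2], whose terms are all
    nonnegative, so that no integrability has to be discussed. *)
Lemma hits_lower_tail (t : R) : (t < #|K|%:R * p)%R ->
  P [set w | hits R A w <= t]%R
    <= (#|K|%:R * p / (#|K|%:R * p - t) ^+ 2)%:E.
Proof.
set M := (#|K|%:R : R); set m := (M * p)%R => tm.
pose g w := ((hits R A w - m) ^+ 2)%R.
have mh := measurable_hits mA.
have mg : measurable_fun setT g.
  by apply: measurable_funX; apply: measurable_funB.
have m_sum : \sum_k P (A k) = m%:E.
  by under eq_bigr do rewrite PA; rewrite sumEFin sumr_const /m mulr_natl.
have m0 : (0 <= m)%R by rewrite -lee_fin -m_sum sume_ge0.
have second_moment :
    \int[P]_w ((hits R A w) ^+ 2)%:E <= (m + m ^+ 2)%:E.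
  rewrite integral_sqr_hits//.
  have step k : \sum_l P (A k `&` A l) <= (p + M * p ^+ 2)%:E.
    rewrite (bigD1 k)//= setIid PA EFinD leeD2l//.
    apply: (@le_trans _ _ (\sum_(l : K) (p ^+ 2)%:E)).
      rewrite [leRHS](bigD1 k)//= -[leLHS]add0e leeD ?lee_fin ?sqr_ge0//.
      by apply: lee_sum => l lk; rewrite PAA// eq_sym.
    by rewrite sumEFin sumr_const -mulr_natl lee_fin.
  apply: (@le_trans _ _ (\sum_(k : K) (p + M * p ^+ 2)%:E)).
    by apply: lee_sum.
  rewrite sumEFin sumr_const lee_fin -mulr_natl -/M /m.
  by rewrite mulrDr exprMn mulrA expr2.
have const : \int[P]_w (m ^+ 2)%:E = (m ^+ 2)%:E.
  by rewrite integral_cst// [X in _ * X](@probability_setT _ _ _ P) mule1.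
have variance : \int[P]_w (g w)%:E <= m%:E.
  have : \int[P]_w (g w)%:E + \int[P]_w ((2 * m)%:E * (hits R A w)%:E)
       = \int[P]_w ((hits R A w) ^+ 2)%:E + \int[P]_w (m ^+ 2)%:E.
    rewrite -!ge0_integralD//.
    - by apply: eq_integral => w _; rewrite /g -EFinM -!EFinD; congr EFin; ring.
    - by move=> w _; rewrite lee_fin sqr_ge0.
    - by apply/measurable_EFinP; exact: measurable_funX.
    - by move=> w _; rewrite lee_fin sqr_ge0.
    - by move=> w _; rewrite lee_fin sqr_ge0.
    - exact/measurable_EFinP.
    - by move=> w _; rewrite -EFinM lee_fin mulr_ge0 ?hits_ge0// mulr_ge0.
    - by apply: measurable_funeM; exact/measurable_EFinP.
  rewrite ge0_integralZl_EFin//; first last.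
  - by rewrite mulr_ge0.
  - exact/measurable_EFinP.
  - by move=> w _; rewrite lee_fin hits_ge0.
  rewrite integral_hits// m_sum const => E.
  rewrite -(@leeD2rE _ ((2 * m)%:E * m%:E))// E.
  apply: (le_trans (leeD2r _ second_moment)).
  by rewrite -EFinM -!EFinD lee_fin le_eqVlt; apply/orP; left; apply/eqP; ring.
have t0 : (0 < (m - t) ^+ 2)%R by rewrite exprn_gt0// subr_gt0.
rewrite EFinM lee_pdivlMr//.
have mg_t : measurable [set w | (m - t) ^+ 2 <= g w]%R.
  by rewrite -[X in measurable X]setTI; exact: measurable_fun_le.
have mh_t : measurable [set w | hits R A w <= t]%R.
  by rewrite -[X in measurable X]setTI; exact: measurable_fun_le.
apply: (@le_trans _ _ (P [set w | (m - t) ^+ 2 <= g w]%R * ((m - t) ^+ 2)%:E)).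
  rewrite lee_pmul2r ?lte_fin//; apply: le_measure; rewrite ?inE// => w /= ht.
  have hm := le_trans ht (ltW tm).
  by rewrite /g -[leRHS]sqrrN opprB ler_sqr ?nnegrE ?subr_ge0 ?(ltW tm) ?lerB.
rewrite muleC; apply: le_trans variance; apply: markov_ge0 => // w.
exact: sqr_ge0.
Qed.

End deviations.

(** * Almost sure events *)

Lemma ae_forall_countable d (T : measurableType d) (R : realType)
    (P : {measure set T -> \bar R}) (K : countType) (Q : K -> T -> Prop) :
  (forall k, {ae P, forall w, Q k w}) -> {ae P, forall w, forall k, Q k w}.
Proof.
move=> aeQ.
have : {ae P, forall w, forall i, if unpickle i is Some k then Q k w else True}.
  by apply: ae_foralln => i; case: unpickle => [k|]; [exact: aeQ|exact: aeW].
by apply: filterS => w Qw k; have := Qw (pickle k); rewrite pickleK.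
Qed.

Lemma ae_imply d (T : measurableType d) (R : realType)
    (P : {measure set T -> \bar R}) (C : Prop) (Q : T -> Prop) :
  (C -> {ae P, forall w, Q w}) -> {ae P, forall w, C -> Q w}.
Proof.
move=> aeQ; have [/aeQ|nC] := pselect C; first by apply: filterS.
by apply: aeW => w /nC.
Qed.

(** A geometric bound from some index on makes the probabilities summable; the
    sequence is shifted past that index before the Borel-Cantelli lemma
    applies. *)
Lemma borel_cantelli_geometric d (T : measurableType d) (R : realType)
    (P : probability T R) (E : nat -> set T) (c r : R) :
  (forall N, measurable (E N)) -> (0 < r < 1)%R ->
  (\forall N \near \oo, P (E N) <= (c * r ^+ N)%:E) ->
  {ae P, forall w, \forall N \near \oo, ~ E N w}.
Proof.
move=> mE /andP[r0 r1] [N0 _ PE].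
pose F k := E (k + N0)%N.
have mF k : measurable (F k) by exact: mE.
pose a := (c * r ^+ N0)%R.
have PF k : P (F k) <= (geometric a r k)%:E.
  apply: le_trans (PE _ _) _; first by rewrite /= leq_addl.
  by rewrite lee_fin /= /a -mulrA -exprD addnC.
have a0 : (0 <= a)%R.
  have := le_trans (measure_ge0 P (F 0%N)) (PF 0%N).
  by rewrite lee_fin /= expr0 mulr1.
have PF0 : P (lim_sup_set F) = 0.
  apply: lim_sup_set_cvg0 => //.
  apply: (@le_lt_trans _ _ (a / (1 - r))%:E); last exact: ltry.
  apply: lime_le; first exact: is_cvg_nneseries.
  apply: nearW => n; apply: (@le_trans _ _ (series (geometric a r) n)%:E).
    by rewrite /series /= -sumEFin; apply: lee_sum => k _; exact: PF.
  by rewrite lee_fin; apply: geometric_le_lim => //; rewrite gtr0_norm.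
exists (lim_sup_set F); split => //.
  apply: bigcap_measurable => // k _.
  by apply: bigcup_measurable => j /= _; exact: mF.
move=> w /= nw n _; apply: contrapT => nF; apply: nw.
exists (n + N0)%N => // N /= nN EN; apply: nF; exists (N - N0)%N.
  by rewrite /= leq_subRL ?(leq_trans _ nN) ?leq_addl// addnC.
by rewrite /F subnK// (leq_trans _ nN) ?leq_addl.
Qed.

(** * Large deviations as exponential bounds *)

Section limn_einf_esup.
Context {R : realType}.
Implicit Types (u : (\bar R)^nat) (l : \bar R).

Lemma limn_esup_le_near u l :
  (\forall n \near \oo, u n <= l) -> limn_esup u <= l.
Proof.
move=> ul; apply: (@le_trans _ _ (ereal_sup (u @` [set n | u n <= l]))).
  by apply: ereal_inf_lbound; exists [set n | u n <= l].
by apply: ge_ereal_sup => _ [n /= unl <-].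
Qed.

Lemma limn_esup_lt_near u l :
  limn_esup u < l -> \forall n \near \oo, u n < l.
Proof.
move=> /ereal_inf_lt[_ [V VF <-] Vl]; apply: filterS VF => n Vn.
by apply: le_lt_trans Vl; apply: ereal_sup_ubound; exists n.
Qed.

Lemma limn_einf_ge_near u l :
  (\forall n \near \oo, l <= u n) -> l <= limn_einf u.
Proof.
move=> lu; rewrite /limn_einf leeNr; apply: limn_esup_le_near.
by apply: filterS lu => n; rewrite leeN2.
Qed.

Lemma limn_einf_gt_near u l :
  l < limn_einf u -> \forall n \near \oo, l < u n.
Proof.
rewrite /limn_einf lteNr => /limn_esup_lt_near.
by apply: filterS => n; rewrite lteN2.
Qed.

End limn_einf_esup.

Lemma ereal_lt_between (R : realType) (x y : \bar R) :
  x < y -> exists r : R, x < r%:E < y.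
Proof.
move: x y => [x| |] [y| |] //.
- by rewrite lte_fin => xy; exists ((x + y) / 2)%R; rewrite !lte_fin !midf_lt.
- by move=> _; exists (x + 1)%R; rewrite lte_fin ltrDl ltr01 ltry.
- by move=> _; exists (y - 1)%R; rewrite ltNyr lte_fin ltrBlDr ltrDl ltr01.
- by move=> _; exists 0%R; rewrite ltNyr ltry.
Qed.

Section log_rate.
Context {R : realType} {X : ptopologicalType}.
Implicit Types (mu : nat -> probability (borel X) R).

Let EFin_log_rate (N : nat) (x : R) : (0 < N)%N ->
  x%:E = (N%:R^-1)%:E * lne (expR (N%:R * x))%:E.
Proof.
move=> N0; rewrite lne_EFin ?expR_gt0// expRK -EFinM mulKf//.
by rewrite pnatr_eq0 -lt0n.
Qed.

Lemma log_rate_le mu (B : set (borel X)) (N : nat) (x : R) : (0 < N)%N ->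
  (log_rate mu B N <= x%:E) = (mu N B <= (expR (N%:R * x))%:E).
Proof.
move=> N0; rewrite /log_rate (EFin_log_rate x N0).
rewrite lee_pmul2l ?lte_fin ?invr_gt0 ?ltr0n//.
by rewrite lee_lne// in_itv/= ?measure_ge0 ?lee_fin ?expR_ge0 leey.
Qed.

Lemma log_rate_ge mu (B : set (borel X)) (N : nat) (x : R) : (0 < N)%N ->
  (x%:E <= log_rate mu B N) = ((expR (N%:R * x))%:E <= mu N B).
Proof.
move=> N0; rewrite /log_rate (EFin_log_rate x N0).
rewrite lee_pmul2l ?lte_fin ?invr_gt0 ?ltr0n//.
by rewrite lee_lne// in_itv/= ?measure_ge0 ?lee_fin ?expR_ge0 leey.
Qed.

Lemma borel_open (U : set X) : open U -> measurable (U : set (borel X)).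
Proof. exact: sub_sigma_algebra. Qed.

Lemma borel_closed (C : set X) : closed C -> measurable (C : set (borel X)).
Proof.
move=> cC; rewrite -[C]setCK; apply: measurableC; apply: borel_open.
exact: closed_openC.
Qed.

(** The two halves of the large deviation principle with the logarithm, the
    limits and the infima unfolded.  The strict inequalities [a < b] and
    [I x < b] leave the room that makes each half equivalent to its
    formulation with [limn_esup], resp. [limn_einf]. *)
Definition exp_upper_bound mu (I : X -> \bar R) := forall (C : set X) (a b : R),
  closed C -> (a < b)%R -> (forall x, C x -> b%:E <= I x) ->
  \forall N \near \oo, mu N C <= (expR (- (N%:R * a)))%:E.

Definition exp_lower_bound mu (I : X -> \bar R) :=
  forall (U : set X) (x : X) (b : R), open U -> U x -> I x < b%:E ->
  \forall N \near \oo, (expR (- (N%:R * b)))%:E <= mu N U.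

Lemma LDP_exp_upper_bound mu I : LDP mu I -> exp_upper_bound mu I.
Proof.
move=> [I0 lscI ldp] C a b cC ab bI.
have mC := borel_closed cC.
have [_ _] := ldp C mC; rewrite -(proj1 (closure_id C) cC) => ub.
have : limn_esup (log_rate mu C) < (- a)%:E.
  apply: (le_lt_trans ub); rewrite EFinN lteN2.
  apply: (@lt_le_trans _ _ b%:E); first by rewrite lte_fin.
  by apply: le_ereal_inf_tmp => _ [x Cx <-]; exact: bI.
move=> /limn_esup_lt_near lt_a.
near=> N.
rewrite -mulrN -log_rate_le//; last by near: N; exact: nbhs_infty_gt.
by apply: ltW; near: N.
Unshelve. all: by end_near. Qed.

Lemma LDP_exp_lower_bound mu I : LDP mu I -> exp_lower_bound mu I.
Proof.
move=> [I0 lscI ldp] U x b oU Ux Ixb.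
have mU := borel_open oU.
have [lb _ _] := ldp U mU; move: lb; rewrite (proj1 (interior_id U) oU) => lb.
have : (- b)%:E < limn_einf (log_rate mu U).
  apply: lt_le_trans lb; rewrite EFinN lteN2; apply: le_lt_trans Ixb.
  by apply: ereal_inf_lbound; exists x.
move=> /limn_einf_gt_near gt_b.
near=> N.
rewrite -mulrN -log_rate_ge//; last by near: N; exact: nbhs_infty_gt.
by apply: ltW; near: N.
Unshelve. all: by end_near. Qed.

Lemma exp_bounds_LDP mu I : (forall x, 0 <= I x) -> lower_semicontinuous I ->
  exp_upper_bound mu I -> exp_lower_bound mu I -> LDP mu I.
Proof.
move=> I0 lscI ub lb; split => // B mB; split; last 1 first.
- pose C : set X := closure (B : set X).
  have mC : measurable (C : set (borel X)).
    by apply: borel_closed; exact: closed_closure.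
  rewrite leeNr leNgt; apply/negP => /ereal_lt_between[b /andP[sb bm]].
  have /ereal_lt_between[a /andP[sa]] := sb; rewrite lte_fin => ab.
  suff : limn_esup (log_rate mu B) <= (- a)%:E.
    by rewrite leNgt EFinN lteNl sa.
  apply: limn_esup_le_near.
  have bI x : C x -> b%:E <= I x.
    by move=> Cx; apply/ltW/(lt_le_trans bm)/ereal_inf_lbound; exists x.
  have muC := ub C a b (@closed_closure _ _) ab bI.
  near=> N.
  rewrite log_rate_le//; last by near: N; exact: nbhs_infty_gt.
  rewrite mulrN; apply: (@le_trans _ _ (mu N C)); last by near: N.
  by apply: le_measure; rewrite ?inE//; exact: subset_closure.
- pose U : set X := interior (B : set X).
  have mU : measurable (U : set (borel X)).
    by apply: borel_open; exact: open_interior.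
  rewrite leeNl leNgt; apply/negP => /ereal_inf_lt[_ [x Ux <-] Ixs].
  have /ereal_lt_between[b /andP[Ixb bs]] := Ixs.
  suff : (- b)%:E <= limn_einf (log_rate mu B).
    by rewrite EFinN leeNl leNgt bs.
  apply: limn_einf_ge_near.
  have muU := lb U x b (@open_interior _ _) Ux Ixb.
  near=> N.
  rewrite log_rate_ge//; last by near: N; exact: nbhs_infty_gt.
  rewrite mulrN; apply: (@le_trans _ _ (mu N U)); first by near: N.
  by apply: le_measure; rewrite ?inE//; exact: interior_subset.
- exact: limn_einf_sup.
Unshelve. all: by end_near. Qed.

End log_rate.

(** * The mass of a fixed set under the empirical measures *)

Lemma empiricalE (R : realType) d (T : measurableType d) (m : nat)
    (m_gt0 : (0 < m)%N) (x : 'I_m -> T) (A : set T) :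
  empirical x m_gt0 A = (m%:R^-1 * \sum_i \1_A (x i))%:E :> \bar R.
Proof.
by rewrite /empirical EFinM -sumEFin; under eq_bigr do rewrite diracE -indicE.
Qed.

Lemma near_expR_le_half (R : realType) (c : R) : (0 < c)%R ->
  \forall N \near \oo, (expR (- (N%:R * c)) <= 2^-1 :> R)%R.
Proof.
move=> c0; near=> N.
rewrite expRN lef_pV2 ?posrE ?expR_gt0//.
apply: (@le_trans _ _ (1 + N%:R * c)%R); last exact: expR_ge1Dx.
have : (c^-1 <= N%:R)%R by near: N; exact: nbhs_infty_ger.
by rewrite -[X in (X <= _)%R]div1r ler_pdivrMr// => ?; lra.
Unshelve. all: by end_near. Qed.

Section sampling.
Context {R : realType} {d d' : measure_display}.
Context {T : measurableType d'} {Omega : measurableType d}.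
Context (P : probability Omega R) (lambda : nat -> probability T R).
Context (xi : forall N : nat, 'I_(2 ^ N) -> {RV P >-> T}).
Hypothesis indep : forall N, (1 <= N)%N -> mutually_independent (@xi N).
Hypothesis law : forall N, (1 <= N)%N ->
  forall i, has_law (@xi N i) (lambda N).

Definition sample_measure (w : Omega) (N : nat) : probability T R :=
  empirical (fun i => @xi N i w) (pow2_gt0 N).

Context (B : set T) (mB : measurable B).

Let A N (i : 'I_(2 ^ N)) : set Omega := @xi N i @^-1` B.

Let mA N i : measurable (@A N i).
Proof. by rewrite -[X in measurable X]setTI; exact: measurable_funP. Qed.

Let sample_measureE w N :
  sample_measure w N B = ((2 ^ N)%:R^-1 * hits R (@A N) w)%:E.
Proof. exact: empiricalE. Qed.

Let prob_hit N i : (0 < N)%N -> P (@A N i) = lambda N B.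
Proof. by move=> N0; rewrite -(law N0 i mB). Qed.

Let prob_hit2 N i j : (0 < N)%N -> i != j ->
  P (@A N i `&` @A N j) = lambda N B * lambda N B.
Proof.
move=> N0 ij; have := indep N0 [set i; j]%SET (fun=> mB).
rewrite big_setU1 ?inE//= big_set1 => E.
rewrite -{1}(prob_hit i N0) -(prob_hit j N0).
have -> : @A N i `&` @A N j =
    [set w | forall k, k \in [set i; j]%SET -> B (@xi N k w)].
  apply/seteqP; split=> w /=.
    by move=> [Bi Bj] k; rewrite !inE => /orP[]/eqP ->.
  by move=> Bw; split; apply: Bw; rewrite !inE eqxx ?orbT.
exact: E.
Qed.

(** By Markov's inequality, [mu_N B >= e^{-N a}] has probability at most
    [e^{N a} * lambda_N B], which is at most [e^{-N (b - a)}]. *)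
Lemma sample_measure_upper (a b : R) : (a < b)%R ->
  (\forall N \near \oo, lambda N B <= (expR (- (N%:R * b)))%:E) ->
  {ae P, forall w, \forall N \near \oo,
    sample_measure w N B <= (expR (- (N%:R * a)))%:E}.
Proof.
move=> ab lamB.
pose t N := ((2 ^ N)%:R * expR (- (N%:R * a)) : R)%R.
have M0 N : (0 < (2 ^ N)%:R :> R)%R by rewrite ltr0n expn_gt0.
pose E N := [set w | t N <= hits R (@A N) w]%R.
have mE N : measurable (E N).
  rewrite -[X in measurable X]setTI; apply: measurable_fun_le => //.
  exact: measurable_hits.
have : {ae P, forall w, \forall N \near \oo, ~ E N w}.
  apply: (@borel_cantelli_geometric _ _ _ _ _ 1%R (expR (- (b - a)))) => //.
    by rewrite expR_gt0 expR_lt1 oppr_lt0 subr_gt0.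
  near=> N.
  have N0 : (0 < N)%N by near: N; exact: nbhs_infty_gt.
  have [p lamp] : exists p : R, lambda N B = p%:E.
    by exists (fine (lambda N B)); rewrite fineK//; exact: fin_num_measure.
  have t0 : (0 < t N)%R by rewrite mulr_gt0// expR_gt0.
  have PA i : P (@A N i) = p%:E by rewrite prob_hit.
  apply: le_trans (hits_upper_tail (@mA N) PA t0) _.
  rewrite lee_fin card_ord mul1r /t invfM mulrACA divff ?gt_eqF// mul1r.
  rewrite ler_pdivrMr ?expR_gt0// -expRM_natl -expRD.
  rewrite (_ : _ + _ = - (N%:R * b))%R; last by ring.
  by rewrite -lee_fin -lamp; near: N.
apply: filterS => w; apply: filterS => N /= /negP; rewrite -ltNge => hN.
by rewrite sample_measureE lee_fin ler_pdivrMl// ltW.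
Unshelve. all: by end_near. Qed.

(** By Chebyshev's inequality, [mu_N B <= lambda_N B / 2] has probability at
    most [4 / (2 ^ N * lambda_N B)], which is at most [4 e^{-N (ln 2 - a)}].
    The factor 1/2 is eventually absorbed by the gap between [a] and [b]. *)
Lemma sample_measure_lower (a b : R) : (a < b)%R -> (a < ln 2)%R ->
  (\forall N \near \oo, (expR (- (N%:R * a)))%:E <= lambda N B) ->
  {ae P, forall w, \forall N \near \oo,
    (expR (- (N%:R * b)))%:E <= sample_measure w N B}.
Proof.
move=> ab a2 lamB.
have M0 N : (0 < (2 ^ N)%:R :> R)%R by rewrite ltr0n expn_gt0.
pose p N := fine (lambda N B).
have lamp N : lambda N B = (p N)%:E.
  by rewrite fineK//; exact: fin_num_measure.
pose E N := [set w | hits R (@A N) w <= (2 ^ N)%:R * p N / 2]%R.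
have mE N : measurable (E N).
  rewrite -[X in measurable X]setTI; apply: measurable_fun_le => //.
  exact: measurable_hits.
have : {ae P, forall w, \forall N \near \oo, ~ E N w}.
  apply: (@borel_cantelli_geometric _ _ _ _ _ 4%R (expR (- (ln 2 - a)))) => //.
    by rewrite expR_gt0 expR_lt1 oppr_lt0 subr_gt0.
  near=> N.
  have N0 : (0 < N)%N by near: N; exact: nbhs_infty_gt.
  have pN : (expR (- (N%:R * a)) <= p N)%R.
    by rewrite -lee_fin -lamp; near: N.
  have p0 := lt_le_trans (expR_gt0 _) pN.
  set m := ((2 ^ N)%:R * p N)%R.
  have m0 : (0 < m)%R by rewrite mulr_gt0.
  have tm : (m / 2 < #|'I_(2 ^ N)|%:R * p N)%R by rewrite card_ord -/m; lra.
  have PA i : P (@A N i) = (p N)%:E by rewrite prob_hit.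
  have PAA i j : i != j -> P (@A N i `&` @A N j) = (p N ^+ 2)%:E.
    by move=> ij; rewrite prob_hit2// lamp -EFinM expr2.
  apply: le_trans (hits_lower_tail (@mA N) PA PAA tm) _.
  rewrite lee_fin card_ord -/m.
  have -> : (m / (m - m / 2) ^+ 2 = 4 * m^-1)%R by field; rewrite gt_eqF.
  rewrite ler_pM2l// -expRM_natl mulrN expRN lef_pV2 ?posrE ?expR_gt0//.
  rewrite mulrBr expRD expRM_natl lnK ?posrE// /m natrX ler_pM2l//.
have half := near_expR_le_half (etrans (subr_gt0 a b) ab).
apply: filterS => w hw; near=> N.
have hN : ~ E N w by near: N.
move: hN => /negP; rewrite -ltNge => hN.
rewrite sample_measureE lee_fin ler_pdivlMl//; apply: le_trans (ltW hN).
rewrite -mulrA ler_pM2l//.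
have pN : (expR (- (N%:R * a)) <= p N)%R.
  by rewrite -lee_fin -lamp; near: N.
apply: (@le_trans _ _ (expR (- (N%:R * a)) / 2)%R); last by rewrite ler_pM2r.
rewrite (_ : - (N%:R * b) = - (N%:R * a) + - (N%:R * (b - a)))%R; last by ring.
by rewrite expRD ler_pM2l ?expR_gt0//; near: N.
Unshelve. all: by end_near. Qed.

(** An empirical measure of [2 ^ N] points gives to every set a multiple of
    [2 ^- N]. *)
Lemma sample_measure_eq0 w N :
  sample_measure w N B < ((2 ^ N)%:R^-1)%:E -> sample_measure w N B = 0.
Proof.
rewrite sample_measureE lte_fin -[X in (_ < X)%R]mulr1 ltr_pM2l; last first.
  by rewrite invr_gt0 ltr0n expn_gt0.
have -> : hits R (@A N) w = (\sum_i (w \in @A N i))%:R%R.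
  by rewrite natr_sum; apply: eq_bigr => i _; rewrite indicE.
by rewrite ltrn1 ltnS leqn0 => /eqP ->; rewrite mulr0.
Qed.

End sampling.

(** * Good rate functions and truncation *)

Definition topological_base (X : topologicalType) (K : Type) (V : K -> set X) :=
  (forall k, open (V k)) /\
  forall (U : set X) x, open U -> U x -> exists2 k, V k x & V k `<=` U.

(** The closed sets for which the upper bound is proved almost surely: when
    [V] is a countable base they form a countable family, rich enough to
    approximate every closed set from outside. *)
Definition avoided_set (X : Type) (K : choiceType) (V : K -> set X) (s : seq K)
  : set X := ~` \bigcup_(k in [set` s]) V k.

Section good_rates.
Context {R : realType} {X : ptopologicalType}.
Implicit Types (I : X -> \bar R) (C : set X).
Implicit Types (mu : nat -> probability (borel X) R).

(** A lower semicontinuous function attains its minimum on a compact set.  Here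
    the part of [C] where [I <= b + 1] is compact and covered by the increasing
    open sets [I > b + 1/(n+1)], so one of these contains it. *)
Lemma good_rate_gap I C (b : R) : lower_semicontinuous I -> good_rate I ->
  closed C -> (0 <= b)%R -> (forall x, C x -> b%:E < I x) ->
  exists2 b' : R, (b < b')%R & forall x, C x -> b'%:E <= I x.
Proof.
move=> lscI goodI cC b0 bI.
pose f n := [set x | (b + n.+1%:R^-1)%:E < I x].
have of_ n : open (f n) by exact: (proj1 (lower_semicontinuousP I) lscI).
have : compact ([set x | I x <= (b + 1)%:E] `&` C).
  by apply: compact_closedI => //; apply: goodI; rewrite addr_ge0.
rewrite compact_cover => /(_ nat setT f)[//|x [_ Cx]|D _ cover_D].
  have /ereal_lt_between[r /andP[]] := bI x Cx.
  rewrite lte_fin -subr_gt0 => rb rI.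
  near \oo => n; exists n => //; rewrite /f /=; apply: le_lt_trans rI.
  rewrite lee_fin -lerBrDl ltW//; near: n.
  exact: (near_infty_natSinv_lt (PosNum rb)).
pose m := \max_(i <- finmap.enum_fset D) i.
exists (b + m.+1%:R^-1)%R; first by rewrite ltrDl.
move=> x Cx; have [Ix|Ix] := leP (I x) (b + 1)%:E; last first.
  by apply/ltW/(le_lt_trans _ Ix); rewrite lee_fin lerD2l invf_le1// ler1n.
have [i Di] := cover_D x (conj Ix Cx).
rewrite /f /=; move/ltW; apply: le_trans.
rewrite lee_fin lerD2l lef_pV2 ?posrE// ler_nat ltnS.
exact: (@leq_bigmax_seq _ _ xpredT id).
Unshelve. all: by end_near. Qed.

Lemma good_rate_compact I (a : R) : (forall x, 0 <= I x) -> good_rate I ->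
  compact [set x | I x <= a%:E].
Proof.
move=> I0 goodI; have [/goodI//|a0] := leP 0%R a.
have -> : [set x | I x <= a%:E] = set0.
  by apply/seteqP; split=> x //= /(le_trans (I0 x)); rewrite lee_fin leNgt a0.
exact: compact0.
Qed.

(** The compact set [I <= a] is covered by finitely many members of the base
    that are disjoint from [C]; the complement of their union is the required
    set. *)
Lemma good_rate_separation I C (a : R) (K : choiceType) (V : K -> set X) :
  topological_base V -> (forall x, 0 <= I x) -> good_rate I ->
  closed C -> (forall x, C x -> a%:E < I x) ->
  exists2 s, C `<=` avoided_set V s & forall x, avoided_set V s x -> a%:E < I x.
Proof.
move=> [oV baseV] I0 goodI cC aI.
have : compact [set x | I x <= a%:E] by exact: good_rate_compact.
rewrite compact_cover.
move=> /(_ K [set k | V k `<=` ~` C] V)[k _|x /= Ixa|D DC cover_D].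
- exact: oV.
- have nCx : (~` C) x by move=> /aI; rewrite ltNge Ixa.
  have [k Vkx VkC] := baseV _ x (closed_openC cC) nCx.
  by exists k.
- exists (finmap.enum_fset D).
    by move=> x Cx [k /= kD Vkx]; have := DC _ kD; rewrite inE => /(_ _ Vkx).
  by move=> x nDx; rewrite ltNge; apply/negP => /cover_D.
Qed.

Lemma closed_avoided_set (K : choiceType) (V : K -> set X) s :
  (forall k, open (V k)) -> closed (avoided_set V s).
Proof. by move=> oV; apply/open_closedC/bigcup_open => k _; exact: oV. Qed.

(** Otherwise [I] would be bounded below by some [b > 0], and the upper bound on
    the whole space would give it a mass smaller than one. *)
Lemma LDP_good_rate_zero mu I : LDP mu I -> good_rate I -> exists x, I x = 0.
Proof.
move=> ldp goodI; have [I0 lscI _] := ldp.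
apply: contrapT => nI0.
have Igt0 x : setT x -> 0%:E < I x.
  move=> _; rewrite lt_neqAle I0 andbT; apply/eqP => I0x; apply: nI0.
  by exists x.
have [b b0 bI] := good_rate_gap lscI goodI closedT (lexx 0%R) Igt0.
have b20 : (b / 2 < b)%R by lra.
have ub := LDP_exp_upper_bound ldp closedT b20 bI.
near \oo => N.
have : mu N [set: borel X] <= (expR (- (N%:R * (b / 2))))%:E by near: N.
rewrite probability_setT lee_fin leNgt expR_lt1 oppr_lt0 mulr_gt0//.
  by rewrite ltr0n; near: N; exact: nbhs_infty_gt.
by rewrite divr_gt0.
Unshelve. all: by end_near. Qed.

Lemma lower_semicontinuous_truncated I (c : R) :
  lower_semicontinuous I -> lower_semicontinuous (truncated_rate c I).
Proof.
move=> lscI x a; rewrite /truncated_rate; case: ifPn => [Ixc aI|].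
  have [V Vx VI] := lscI x a aI; exists V => // y /VI aIy.
  by case: ifPn => //; rewrite ltry.
rewrite -ltNge => /lscI[V Vx VI] _; exists V => // y /VI.
by rewrite ltNge => /negbTE ->; rewrite ltry.
Qed.

(** If the truncated rate exceeds [c] on [C] then [I > c] on [C], hence
    [I >= c'] on [C] for some [c' > c]; so the mass of [C] is eventually less than
    [e^{-N c}], and it vanishes by the hypothesis on small masses. *)
Lemma truncated_exp_upper_bound mu I (c : R) : lower_semicontinuous I ->
  good_rate I -> (0 <= c)%R -> exp_upper_bound mu I ->
  (forall N (B : set (borel X)), measurable B ->
    mu N B < (expR (- (N%:R * c)))%:E -> mu N B = 0) ->
  exp_upper_bound mu (truncated_rate c I).
Proof.
move=> lscI goodI c0 ub atom C a b cC ab bJ.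
have [bc|cb] := leP b c.
  apply: ub cC ab _ => x /bJ; rewrite /truncated_rate; case: ifPn => // + _.
  by rewrite -ltNge => /ltW; apply: le_trans; rewrite lee_fin.
have cI x : C x -> c%:E < I x.
  move=> /bJ; rewrite /truncated_rate; case: ifPn => [Ixc bI|].
    by have := le_trans bI Ixc; rewrite lee_fin leNgt cb.
  by rewrite -ltNge.
have [c' cc' c'I] := good_rate_gap lscI goodI cC c0 cI.
pose e := ((c + c') / 2)%R.
have ce : (c < e)%R by rewrite midf_lt.
have ec' : (e < c')%R by rewrite midf_lt.
have muC := ub C e c' cC ec' c'I.
near=> N.
rewrite (atom N C (borel_closed cC)) ?lee_fin ?expR_ge0//.
have N0 : (0 < N)%N by near: N; exact: nbhs_infty_gt.
apply: (@le_lt_trans _ _ (expR (- (N%:R * e)))%:E); first by near: N.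
by rewrite lte_fin ltr_expR ltrN2 ltr_pM2l// ltr0n.
Unshelve. all: by end_near. Qed.

(** The lower bound at a point of rate exactly [c] comes from the points of
    smaller rate in the same open set. *)
Lemma truncated_exp_lower_bound mu I (c : R) :
  (forall (U : set X) x (b : R), open U -> U x -> I x < b%:E -> (b < c)%R ->
    \forall N \near \oo, (expR (- (N%:R * b)))%:E <= mu N U) ->
  (forall (U : set X) x, open U -> U x -> I x = c%:E ->
    exists2 y, U y & I y < c%:E) ->
  exp_lower_bound mu (truncated_rate c I).
Proof.
move=> lb approx U x b oU Ux; rewrite /truncated_rate.
case: ifPn => // Ixc Ixb.
have [y [Uy Iyc Iyb]] : exists y, [/\ U y, I y < c%:E & I y < b%:E].
  have [Ixc'|cIx] := ltP (I x) c%:E; first by exists x.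
  have Ix : I x = c%:E by apply/eqP; rewrite eq_le Ixc.
  have [y Uy Iyc] := approx U x oU Ux Ix.
  by exists y; split => //; rewrite (lt_trans Iyc)// -Ix.
have : I y < (Num.min b c)%:E by rewrite EFin_min lt_min Iyb.
move=> /ereal_lt_between[e /andP[Iye]]; rewrite lte_fin lt_min => /andP[eb ec].
apply: filterS (lb U y e oU Uy Iye ec) => N; apply: le_trans.
by rewrite lee_fin ler_expR lerN2 ler_wpM2l// ltW.
Qed.

End good_rates.

(** * The large deviation principle for the empirical measures *)

Section sample_LDP.
Context {R : realType} {X : ptopologicalType} {d : measure_display}.
Context {Omega : measurableType d} (P : probability Omega R).
Context (lambda : nat -> probability (borel X) R) (I : X -> \bar R).
Context (xi : forall N : nat, 'I_(2 ^ N) -> {RV P >-> borel X}).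
Hypothesis indep : forall N, (1 <= N)%N -> mutually_independent (@xi N).
Hypothesis law : forall N, (1 <= N)%N ->
  forall i, has_law (@xi N i) (lambda N).
Context (K : countType) (V : K -> set X).
Hypothesis baseV : topological_base V.
Hypotheses (ldp : LDP lambda I) (goodI : good_rate I).

(** One null set serves all closed sets: it is enough to exclude the failures of
    the bound for the countably many avoided sets and rational exponents.  The
    rationals [a < q1 < q2 < b] leave room for both the separation of [C] and
    the estimate of the avoided set. *)
Lemma ae_exp_upper_bound :
  {ae P, forall w, exp_upper_bound (sample_measure xi w) I}.
Proof.
have [oV _] := baseV; have [I0 _ _] := ldp.
pose F := @avoided_set X K V.
have : {ae P, forall w, forall sab : seq K * rat * rat,
    let: (s, a, b) := sab in
    ((ratr a < ratr b :> R)%R /\ forall x, F s x -> (ratr b)%:E <= I x) ->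
    \forall N \near \oo,
      sample_measure xi w N (F s) <= (expR (- (N%:R * ratr a)))%:E}.
  apply: ae_forall_countable => -[[s a] b]; apply: ae_imply => -[ab bI].
  have cF : closed (F s) by exact: closed_avoided_set.
  apply: (sample_measure_upper law (borel_closed cF) (midf_lt ab).1).
  exact: (LDP_exp_upper_bound ldp cF (midf_lt ab).2 bI).
apply: filterS => w Fw C a b cC ab bI.
have [q1 /andP[aq1 q1b]] := rat_in_itvoo ab.
have [q2 /andP[q12 q2b]] := rat_in_itvoo q1b.
have q2I x : C x -> (ratr q2)%:E < I x.
  by move=> /bI; apply: lt_le_trans; rewrite lte_fin.
have [s CF FI] := good_rate_separation baseV I0 goodI cC q2I.
have muF : \forall N \near \oo,
    sample_measure xi w N (F s) <= (expR (- (N%:R * ratr q1)))%:E.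
  by apply: (Fw (s, q1, q2)); split => // x /FI/ltW.
apply: filterS muF => N muF.
apply: (@le_trans _ _ (sample_measure xi w N (F s))).
  apply: le_measure; rewrite ?inE//; apply: borel_closed => //.
  exact: closed_avoided_set.
apply: (le_trans muF).
by rewrite lee_fin ler_expR lerN2 ler_wpM2l// ltW.
Qed.

(** Restricted to exponents below [ln 2]: a set of larger rate is expected to
    contain no sample point at all. *)
Lemma ae_exp_lower_bound :
  {ae P, forall w, forall (U : set X) x (b : R), open U -> U x ->
    I x < b%:E -> (b < ln 2)%R ->
    \forall N \near \oo, (expR (- (N%:R * b)))%:E <= sample_measure xi w N U}.
Proof.
have [oV base] := baseV.
have : {ae P, forall w, forall kb : K * rat, let: (k, b) := kb in
    ((ratr b < ln 2 :> R)%R /\ exists2 x, V k x & I x < (ratr b)%:E) ->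
    \forall N \near \oo,
      (expR (- (N%:R * ratr b)))%:E <= sample_measure xi w N (V k)}.
  apply: ae_forall_countable => -[k b]; apply: ae_imply => -[b2 [x Vx]].
  move=> /ereal_lt_between[a /andP[Ixa]]; rewrite lte_fin => ab.
  apply: (sample_measure_lower indep law (borel_open (oV k)) ab).
    exact: lt_trans b2.
  exact: (LDP_exp_lower_bound ldp (oV k) Vx Ixa).
apply: filterS => w Vw U x b oU Ux Ixb b2.
have [a /andP[Ixa]] := ereal_lt_between Ixb; rewrite lte_fin => ab.
have [q /andP[aq qb]] := rat_in_itvoo ab.
have [k Vkx VkU] := base U x oU Ux.
have muV : \forall N \near \oo,
    (expR (- (N%:R * ratr q)))%:E <= sample_measure xi w N (V k).
  apply: (Vw (k, q)); split; first exact: lt_trans b2.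
  by exists x => //; apply: lt_trans Ixa _; rewrite lte_fin.
apply: filterS muV => N muV.
apply: (@le_trans _ _ (sample_measure xi w N (V k))).
  by apply: le_trans muV; rewrite lee_fin ler_expR lerN2 ler_wpM2l// ltW.
by apply: le_measure; rewrite ?inE//; apply: borel_open.
Qed.

(** The hypothesis is what the lower bound requires at the points of rate exactly
    [ln 2], around which the expected number of sample points is not known to
    grow exponentially. *)
Theorem sample_measure_LDP :
  (forall (U : set X) x, open U -> U x -> I x = (ln 2)%:E ->
    exists2 y, U y & I y < (ln 2)%:E) ->
  {ae P, forall w, LDP (sample_measure xi w) (truncated_rate (ln 2) I)}.
Proof.
move=> approx; have [I0 lscI _] := ldp.
have ln2_ge0 : (0 <= ln 2 :> R)%R by rewrite ln_ge0// ler1n.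
apply: filterS2 ae_exp_upper_bound ae_exp_lower_bound => w ub lb.
apply: exp_bounds_LDP.
- by move=> x; rewrite /truncated_rate; case: ifPn.
- exact: lower_semicontinuous_truncated.
- apply: truncated_exp_upper_bound => // N B mB.
  by rewrite expRN expRM_natl lnK ?posrE// -natrX; exact: sample_measure_eq0.
- exact: truncated_exp_lower_bound.
Qed.

End sample_LDP.

(** * Euclidean space and quasi-convex rates *)

(** The balls of rational centre and of radius [1/(k+1)]: one whose centre is
    within [1/(k+1)] of [x] stays within [2/(k+1)] of [x]. *)
Lemma rV_topological_base (R : realType) (n : nat) :
  topological_base (fun qk : 'rV[rat]_n * nat =>
    ball (map_mx ratr qk.1 : 'rV[R]_n) qk.2.+1%:R^-1).
Proof.
split=> [[q k]|U x oU Ux]; first exact: ball_open.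
have /nbhs_ballP[e /= e0 eU] : nbhs x U by exact: open_nbhs_nbhs.
have e20 : (0 < e / 2)%R by rewrite divr_gt0.
have [k ke] : exists k : nat, (k.+1%:R^-1 < e / 2)%R.
  near \oo => k; exists k; near: k.
  exact: (near_infty_natSinv_lt (PosNum e20)).
have k0 : (0 < k.+1%:R^-1 :> R)%R by rewrite invr_gt0 ltr0n.
have close j : {q : rat | `|ratr q - x ord0 j| < k.+1%:R^-1}%R.
  apply: cid.
  have /rat_in_itvoo[q] : (x ord0 j - k.+1%:R^-1 < x ord0 j + k.+1%:R^-1)%R.
    by rewrite ltrBlDr -addrA ltrDl addr_gt0.
  by rewrite in_itv/= -ltr_distl; exists q.
pose q := \row_j sval (close j).
have qx : ball (map_mx ratr q : 'rV[R]_n) k.+1%:R^-1 x.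
  split => // i j; rewrite !mxE [i]ord1; exact: (svalP (close j)).
exists (q, k) => //= y qy; apply: eU.
rewrite [e]splitr; apply: (@ball_triangle _ _ (map_mx ratr q : 'rV[R]_n)).
  by apply: ball_sym; apply: le_ball qx; exact: ltW.
by apply: le_ball qy; exact: ltW.
Unshelve. all: by end_near. Qed.

(** The open segment from [x] to [x0] accumulates at [x], and strict
    quasi-convexity makes [I] smaller than [I x] along it. *)
Lemma strictly_quasi_convex_approx (R : realType) (n : nat)
    (I : 'rV[R]_n -> \bar R) (x0 x : 'rV[R]_n) (U : set 'rV[R]_n) :
  strictly_quasi_convex I -> I x0 < I x -> I x < +oo -> open U -> U x ->
  exists2 y, U y & I y < I x.
Proof.
move=> qc Ix0x Ix oU Ux.
have x0x : x0 != x by apply: contraTneq Ix0x => ->; rewrite ltxx.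
pose f (t : R) := (t *: x0 + (1 - t) *: x)%R.
have cvg_x : f t @[t --> (0%R : R)^'+] --> x.
  rewrite -[x in _ --> x](_ : f 0%R = x); last first.
    by rewrite /f scale0r add0r subr0 scale1r.
  apply: cvg_at_right_filter; apply: cvgD.
    by apply: cvgZr_tmp; exact: cvg_id.
  by apply: cvgZr_tmp; apply: cvgB; [exact: cvg_cst|exact: cvg_id].
near (0%R : R)^'+ => t.
exists (f t).
  near: t; apply: cvg_x; exact: open_nbhs_nbhs.
rewrite (lt_le_trans (qc _ _ t x0x (lt_trans Ix0x Ix) Ix _))//.
  by apply/andP; split; near: t; [exact: nbhs_right_gt|exact: nbhs_right_lt].
by rewrite ge_max (ltW Ix0x) lexx.
Unshelve. all: by end_near. Qed.

Theorem theorem0p2p1 (R : realType) (n : nat)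
    (lambda : nat -> probability (borel 'rV[R]_n) R)
    (I : 'rV[R]_n -> \bar R)
    (HLDP : LDP lambda I) (Hgood : good_rate I)
    (Hqc : strictly_quasi_convex I)
    (d : measure_display) (Omega : measurableType d) (P : probability Omega R)
    (xi : forall N : nat, 'I_(2 ^ N) -> {RV P >-> borel 'rV[R]_n})
    (Hindep : forall N : nat, (1 <= N)%N -> mutually_independent (xi N))
    (Hlaw : forall N : nat, (1 <= N)%N ->
      forall i : 'I_(2 ^ N), has_law (xi N i) (lambda N)) :
  {ae P, forall w : Omega,
    LDP (fun N : nat => empirical (fun i => xi N i w) (pow2_gt0 N))
        (truncated_rate (ln 2) I)}.
Proof.
apply: (sample_measure_LDP Hindep Hlaw (@rV_topological_base R n) HLDP Hgood).
move=> U x oU Ux Ix; have [x0 Ix0] := LDP_good_rate_zero HLDP Hgood.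
rewrite -Ix; apply: (strictly_quasi_convex_approx (x0 := x0)) => //.
  by rewrite Ix0 Ix lte_fin ln_gt0// ltr1n.
by rewrite Ix ltry.
Qed.
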